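(* Let $M$ be a Riemannian manifold and suppose $f_{1}, f_{2}:M\to[0,\infty)$ are functions subdifferentiable at $p\in M$. Then $f_{1}f_{2}$ is subdifferentiable at $p$, and $$f_{1}(p)D^{-}f_{2}(p)+f_{2}(p)D^{-}f_{1}(p)\subseteq D^{-}(f_{1}f_{2})(p).$$
   Context: A Riemannian manifold is a $C^\infty$ manifold modelled on a Hilbert space (possibly infinite-dimensional) with a $C^\infty$ assignment of scalar products on the tangent spaces inducing equivalent norms. For $f:M\to\mathbb{R}$ and $p\in M$, the subdifferential $D^{-}f(p)\subset T^*M_p$ is the set of all $d\varphi(p)$ with $\varphi\in C^1(M,\mathbb{R})$ such that $f-\varphi$ attains a local minimum at $p$; $f$ is subdifferentiable at $p$ if $D^{-}f(p)\ne\emptyset$. Sums of sets are Minkowski sums, and $cA=\{ca:a\in A\}$. *)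

(* Defs.v *)
From HB Require Import structures.
From mathcomp Require Import all_boot all_order all_algebra.
From mathcomp Require Import sesquilinear ring.
From mathcomp Require Import mathcomp_extra boolp classical_sets functions.
From mathcomp Require Import reals.
From mathcomp Require Import topology normedtype landau derive.

Set Implicit Arguments.
Unset Strict Implicit.
Unset Printing Implicit Defensive.

Import Order.TTheory GRing.Theory Num.Theory.
Import numFieldNormedType.Exports.

Local Open Scope classical_set_scope.
Local Open Scope ring_scope.

Section BoundedLinearMaps.
Context {R : realType} {V W : normedModType R}.

Definition blin_pred : {pred V -> W} :=
  fun f => `[< linear f /\ continuous f >].

Record blin := Blin { blin_fun :> V -> W; blin_funP : blin_fun \in blin_pred }.

HB.instance Definition _ := [isSub for blin_fun].
HB.instance Definition _ := [Choice of blin by <:].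

Lemma blin_predP f : reflect (linear f /\ continuous f) (f \in blin_pred).
Proof. by rewrite unfold_in; exact: asboolP. Qed.

Fact blin_submod_closed : submod_closed blin_pred.
Proof.
split=> [|a f g /blin_predP[lf cf] /blin_predP[lg cg]]; apply/blin_predP.
  by split=> [b x y|x]; [rewrite /= scaler0 addr0|exact: cst_continuous].
split=> [b x y|x].
  rewrite !fctE lf lg !scalerDr !scalerA [a * b]mulrC.
  by rewrite -!addrA; congr (_ + _); rewrite addrCA.
by apply: cvgD; [apply: cvgZl_tmp; exact: cf|exact: cg].
Qed.

HB.instance Definition _ :=
  GRing.isSubmodClosed.Build R (V -> W) blin_pred blin_submod_closed.
HB.instance Definition _ := [SubChoice_isSubLmodule of blin by <:].

Lemma blin_linear (f : blin) : linear f.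
Proof. by case: f => f /= /blin_predP[]. Qed.

Lemma blin_continuous (f : blin) : continuous f.
Proof. by case: f => f /= /blin_predP[]. Qed.

HB.instance Definition _ (f : blin) :=
  GRing.isLinear.Build R V W *:%R f (blin_linear f).

Definition opnorm (f : blin) : R :=
  sup [set `|f x| | x in [set x : V | `|x| <= 1]].

Lemma has_sup_opnorm (f : blin) :
  has_sup [set `|f x| | x in [set x : V | `|x| <= 1]].
Proof.
split; first by exists `|f 0|, 0 => //=; rewrite normr0.
have /bounded_funP/(_ 1)[M fM] :=
  continuous_linear_bounded 0 (@blin_continuous f 0).
by exists M => _ [x /= x1 <-]; exact: fM.
Qed.

Lemma opnorm_ub (f : blin) (x : V) : `|f x| <= opnorm f * `|x|.
Proof.
have [->|x0] := eqVneq x 0; first by rewrite linear0 !normr0 mulr0.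
rewrite -ler_pdivrMr ?normr_gt0// mulrC.
rewrite -[X in X * _ <= _]ger0_norm ?invr_ge0// -normrZ -linearZ.
apply: sup_upper_bound; first exact: has_sup_opnorm.
by exists (`|x|^-1 *: x) => //=; rewrite normfZV.
Qed.

Lemma opnorm_le (f : blin) (c : R) :
  (forall x, `|x| <= 1 -> `|f x| <= c) -> opnorm f <= c.
Proof.
move=> fc; apply: ge_sup; first by case: (has_sup_opnorm f).
by move=> _ [x /= x1 <-]; exact: fc.
Qed.

Lemma opnorm_ge0 (f : blin) : 0 <= opnorm f.
Proof.
apply: (le_trans (normr_ge0 (f 0))).
apply: sup_upper_bound; first exact: has_sup_opnorm.
by exists 0 => //=; rewrite normr0.
Qed.

Fact opnormD (f g : blin) : opnorm (f + g) <= opnorm f + opnorm g.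
Proof.
apply: opnorm_le => x x1; apply: le_trans (ler_normD _ _) _.
by apply: lerD; apply: le_trans (opnorm_ub _ _) _;
  rewrite ler_piMr ?opnorm_ge0.
Qed.

Fact opnormZ (a : R) (f : blin) : opnorm (a *: f) = `|a| * opnorm f.
Proof.
have le b g : opnorm (b *: g) <= `|b| * opnorm g.
  apply: opnorm_le => x x1; rewrite -[(b *: g) x]/(b *: g x) normrZ.
  apply: ler_wpM2l => //; apply: le_trans (opnorm_ub _ _) _.
  by rewrite ler_piMr ?opnorm_ge0.
apply/eqP; rewrite eq_le le/=.
have [->|a0] := eqVneq a 0; first by rewrite normr0 mul0r opnorm_ge0.
rewrite -ler_pdivlMl ?normr_gt0// -normfV.
by rewrite -[in leLHS](scalerK a0 f) le.
Qed.

Fact opnorm0_eq0 (f : blin) : opnorm f = 0 -> f = 0.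
Proof.
move=> f0; apply/val_inj/funext => x /=; apply/eqP.
by rewrite -normr_le0 (le_trans (opnorm_ub f x))// f0 mul0r.
Qed.

HB.instance Definition _ :=
  Lmodule_isNormed.Build R blin opnormD opnormZ opnorm0_eq0.

End BoundedLinearMaps.
Arguments blin {R} V W.

Section Smoothness.
Context {R : realType} {V : normedModType R}.

(* The Frechet derivative of [f] at [x] as an element of the normed space of
   bounded linear maps; it is 0 when ['d f x] is not continuous, hence it is
   only meaningful where [f] is differentiable. *)
Definition frechet {W : normedModType R} (f : V -> W) (x : V) : blin V W :=
  insubd 0 ('d f x : V -> W).

Lemma frechetE {W : normedModType R} (f : V -> W) (x : V) :
  differentiable f x -> frechet f x = 'd f x :> (V -> W).
Proof.
move=> fx; rewrite /frechet /= val_insubd.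
rewrite ifT//; apply/blin_predP; split; last exact: diff_continuous.
exact: linearP.
Qed.

(* [f] is of class C^k on [U], meant for [U] open *)
Fixpoint Ck_on (k : nat) {W : normedModType R} (U : set V) (f : V -> W) :
    Prop :=
  match k with
  | 0 => forall x, U x -> {for x, continuous f}
  | j.+1 => (forall x, U x -> differentiable f x) /\ Ck_on j U (frechet f)
  end.

Definition smooth_on {W : normedModType R} (U : set V) (f : V -> W) : Prop :=
  forall k, Ck_on k U f.

End Smoothness.

HB.mixin Record CompleteNormedModule_isHilbert (R : realType) E
    & CompleteNormedModule R E := {
  inner : {dot E for idfun};
  inner_normE : forall x : E, inner x x = `|x| ^+ 2
}.

#[short(type="hilbertType")]
HB.structure Definition Hilbert (R : realType) :=
  {E of CompleteNormedModule R E & CompleteNormedModule_isHilbert R E}.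

Section Charts.
Context {R : realType} {E : hilbertType R}.

(* A homeomorphism from an open subset of [M] onto an open subset of [E]; both
   directions are total functions, whose values off the domain and off the
   image are irrelevant. *)
Record chart (M : topologicalType) := Chart {
  chart_fun :> M -> E;
  chart_inv : E -> M;
  chart_dom : set M;
  chart_dom_open : open chart_dom;
  chart_cod_open : open (chart_fun @` chart_dom);
  chart_funK : forall p, chart_dom p -> chart_inv (chart_fun p) = p;
  chart_fun_continuous : forall p, chart_dom p -> {for p, continuous chart_fun};
  chart_inv_continuous : forall x, (chart_fun @` chart_dom) x ->
    {for x, continuous chart_inv}
}.

Definition chart_cod (M : topologicalType) (c : chart M) : set E :=
  c @` chart_dom c.

End Charts.
Arguments chart {R} E M.

Section Manifolds.
Context {R : realType} {E : hilbertType R}.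

(* A C^oo manifold modelled on [E], given by an atlas that need not be maximal;
   no countability or connectedness is imposed. *)
Record manifold := Manifold {
  carrier :> topologicalType;
  carrier_hausdorff : hausdorff_space carrier;
  atlas : set (chart E carrier);
  atlas_cover : forall p : carrier, exists2 c, atlas c & chart_dom c p;
  atlas_smooth : forall c d, atlas c -> atlas d ->
    smooth_on (c @` (chart_dom c `&` chart_dom d)) (d \o chart_inv c)
}.

Record chart_at (M : manifold) (p : M) := ChartAt {
  chart_of :> chart E M;
  chart_of_atlas : atlas chart_of;
  chart_of_dom : chart_dom chart_of p
}.

Definition some_chart (M : manifold) (p : M) : chart_at p :=
  let: exist2 _ ac cp := cid2 (atlas_cover p) in ChartAt ac cp.

Section Tangent.
Context {M : manifold} (p : M).

(* A tangent vector at [p] is the family of its representatives in the charts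
   at [p], related by the derivatives of the transition maps. *)
Definition tangent_pred : {pred chart_at p -> E} := fun v =>
  `[< forall c d : chart_at p, v d = 'd (d \o chart_inv c) (c p) (v c) >].

Record tangent := Tangent {
  rep :> chart_at p -> E;
  repP : rep \in tangent_pred
}.

Lemma rep_change (v : tangent) (c d : chart_at p) :
  v d = 'd (d \o chart_inv c) (c p) (v c).
Proof. by have := repP v; rewrite unfold_in => /asboolP/(_ c d). Qed.

HB.instance Definition _ := [isSub for rep].
HB.instance Definition _ := [Choice of tangent by <:].

Fact tangent_submod_closed : submod_closed tangent_pred.
Proof.
split=> [|a u v]; rewrite !unfold_in.
  by apply/asboolP => c d; rewrite linear0.
move=> /asboolP up /asboolP vp; apply/asboolP => c d.
by rewrite linearP -up -vp.
Qed.

HB.instance Definition _ := GRing.isSubmodClosed.Build R (chart_at p -> E)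
  tangent_pred tangent_submod_closed.
HB.instance Definition _ := [SubChoice_isSubLmodule of tangent by <:].

End Tangent.
End Manifolds.
Arguments manifold {R} E.
Arguments tangent {R E M} p.
Arguments some_chart {R E M} p.

(* In [metric_equiv], any chart at [p] carries the norm of the model space to the
   tangent space. In [metric_smooth], [G] is the local expression of the metric
   in the chart [c]; it is unique on [chart_cod c] by [tangent_rep_bij] below. *)
Record riemannianManifold (R : realType) (E : hilbertType R) :=
  RiemannianManifold {
  base_manifold :> manifold E;
  metric : forall p : base_manifold, {dot (tangent p) for idfun};
  metric_equiv : forall (p : base_manifold) (c : chart_at p),
    exists a b : R, [/\ 0 < a, 0 < b & forall v : tangent p,
      a * `|v c| <= Num.sqrt (metric p v v) <= b * `|v c|];
  metric_smooth : forall c, atlas c ->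
    exists2 G : E -> blin E (blin E R^o), smooth_on (chart_cod c) G &
      forall p (ac : atlas c) (cp : chart_dom c p) (u v : tangent p),
        metric p u v = G (c p) (u (ChartAt ac cp)) (v (ChartAt ac cp))
}.

Section DotProduct.
Context {R : realType} {U : lmodType R} (b : {dot U for idfun}).

Let bC u v : b u v = b v u.
Proof. by have := hermC b u v; rewrite /= expr0 mul1r. Qed.

Lemma dot_gt0 u : u != 0 -> 0 < b u u.
Proof. exact: neq0_dnorm_gt0. Qed.

Lemma dot_ge0 u : 0 <= b u u.
Proof. by have [->|/dot_gt0/ltW//] := eqVneq u 0; rewrite linear0l. Qed.

Let dotDZ x y u v : b (x *: u + y *: v) (x *: u + y *: v) =
  x ^+ 2 * b u u + x * y * b u v *+ 2 + y ^+ 2 * b v v.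
Proof.
have scE (a c : R) : a *: (c : R^o) = a * c by [].
rewrite linearDl/= !linearDr/= !linearZl_LR/= !linearZr_LR/= (bC v u).
by rewrite !scE; ring.
Qed.

Lemma dot_cauchy_schwarz u v : b u v ^+ 2 <= b u u * b v v.
Proof.
have [->|v0] := eqVneq v 0; first by rewrite !linear0 expr0n mulr0.
have vv := dot_gt0 v0.
have := dot_ge0 (b v v *: u + (- b u v) *: v).
rewrite dotDZ -(pmulr_rge0 _ vv) -subr_ge0.
rewrite -(pmulr_rge0 (b u u * b v v - _) (mulr_gt0 vv vv)).
by congr (0 <= _); ring.
Qed.

Lemma dot_normD u v : Num.sqrt (b (u + v) (u + v)) <=
  Num.sqrt (b u u) + Num.sqrt (b v v).
Proof.
rewrite -(@ler_pXn2r _ 2)// ?nnegrE ?addr_ge0 ?sqrtr_ge0//.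
rewrite sqrrD !sqr_sqrtr ?dot_ge0//.
have := dotDZ 1 1 u v; rewrite !scale1r => ->.
rewrite !expr1n !mul1r lerD2r lerD2l lerMn2r/= -sqrtrM ?dot_ge0//.
apply: le_trans (ler_norm _) _; rewrite -sqrtr_sqr ler_wsqrtr//.
exact: dot_cauchy_schwarz.
Qed.

Lemma dot_normZ a u : Num.sqrt (b (a *: u) (a *: u)) =
  `|a| * Num.sqrt (b u u).
Proof.
have := dotDZ a 0 u 0; rewrite scale0r addr0 => ->.
rewrite mulr0 mul0r mul0rn addr0 expr0n/= mul0r addr0.
by rewrite sqrtrM ?sqr_ge0// sqrtr_sqr.
Qed.

Lemma dot_norm0_eq0 u : Num.sqrt (b u u) = 0 -> u = 0.
Proof.
move=> /eqP; rewrite sqrtr_eq0 => uu; apply/eqP/negP => /negP/dot_gt0.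
by rewrite ltNge uu.
Qed.

End DotProduct.

Section TangentSpace.
Context {R : realType} {E : hilbertType R} {M : riemannianManifold E}.

Section Normed.
Variable p : M.

(* the tangent space, normed by the scalar product at [p] *)
Definition tangent_space : Type := tangent p.

HB.instance Definition _ := GRing.Lmodule.on tangent_space.

Definition metric_norm (v : tangent_space) : R := Num.sqrt (metric p v v).

HB.instance Definition _ := Lmodule_isNormed.Build R tangent_space
  (dot_normD (metric p)) (dot_normZ (metric p))
  (@dot_norm0_eq0 _ _ (metric p)).

(* the continuous dual *)
Definition cotangent_space : Type := blin tangent_space R^o.
HB.instance Definition _ := NormedModule.on cotangent_space.
End Normed.

Definition C1 (phi : M -> R) : Prop :=
  forall c, atlas c -> Ck_on 1 (chart_cod c) (phi \o chart_inv c : E -> R^o).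

End TangentSpace.

Section LocalDifferential.
Context {R : realType} {V W : normedModType R}.

Lemma near_eq_diff (f g : V -> W) (x : V) :
  (\forall y \near x, f y = g y) -> differentiable f x ->
  differentiable g x /\ 'd g x = 'd f x :> (V -> W).
Proof.
move=> fg fx.
have gx : g \o shift x = cst (g x) + 'd f x +o_ 0 id.
  apply/eqaddoP => e e0; have /eqaddoP/(_ e e0) := diff_locally fx.
  have sc : shift x y @[y --> (0 : V)] --> x.
    rewrite -[X in _ --> X]add0r.
    by apply: cvgD; [exact: cvg_id|exact: cvg_cst].
  have fg0 : \forall h \near (0 : V), f (h + x) = g (h + x) by exact: sc _ fg.
  apply: filterS2 fg0 => h fgh; rewrite !fctE /= fgh.
  by rewrite (nbhs_singleton fg).
have dgx := diff_unique (diff_continuous fx) gx.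
split; last exact: dgx.
apply/diff_locallyP; rewrite dgx; split; last exact: gx.
exact: diff_continuous fx.
Qed.

End LocalDifferential.

Section ChangeOfChart.
Context {R : realType} {E : hilbertType R} {M : manifold E} {p : M}.

Lemma chart_invK_near (c d : chart_at p) :
  \forall x \near c p, chart_inv d (d (chart_inv c x)) = chart_inv c x.
Proof.
have cp := chart_of_dom c; have dp := chart_of_dom d.
have ci : chart_inv c x @[x --> c p] --> p.
  have : {for c p, continuous (chart_inv c)}.
    by apply: chart_inv_continuous; exists p.
  by rewrite /prop_for /continuous_at (chart_funK cp).
have dp_near : nbhs p (chart_dom d).
  by apply: open_nbhs_nbhs; split=> //; exact: chart_dom_open.
have : nbhs (c p) (chart_inv c @^-1` chart_dom d) by exact: ci _ dp_near.
by apply: filterS => x dx; rewrite chart_funK.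
Qed.

Lemma differentiable_transition (c d : chart_at p) :
  differentiable (d \o chart_inv c) (c p).
Proof.
have [+ _] := atlas_smooth (chart_of_atlas c) (chart_of_atlas d) 1.
apply; exists p => //; split; exact: chart_of_dom.
Qed.

Lemma diff_change_chart (W : normedModType R) (f : M -> W) (c d : chart_at p) :
  differentiable (f \o chart_inv d) (d p) ->
  'd (f \o chart_inv c) (c p) =
  'd (f \o chart_inv d) (d p) \o 'd (d \o chart_inv c) (c p) :> (E -> W).
Proof.
move=> fd; have dt := differentiable_transition c d.
have dcp : (d \o chart_inv c) (c p) = d p.
  by rewrite /= chart_funK//; exact: chart_of_dom.
have fd' : differentiable (f \o chart_inv d) ((d \o chart_inv c) (c p)).
  by rewrite dcp.
have := diff_comp dt fd'; rewrite dcp => <-.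
have ffn : \forall x \near c p,
    ((f \o chart_inv d) \o (d \o chart_inv c)) x = (f \o chart_inv c) x.
  by apply: filterS (chart_invK_near c d) => x /= ->.
exact: proj2 (near_eq_diff ffn (differentiable_comp dt fd')).
Qed.

(* The tangent space at [p] is identified with the model space by any chart. *)
Lemma tangent_rep_bij (c : chart_at p) : bijective (fun v : tangent p => v c).
Proof.
pose w (e : E) (d : chart_at p) : E := 'd (d \o chart_inv c) (c p) e.
have wP e : w e \in tangent_pred (p := p).
  rewrite unfold_in; apply/asboolP => d d'; rewrite /w.
  have := diff_change_chart (f := d') c (differentiable_transition d d').
  by move=> /(congr1 (fun h : E -> E => h e)).
exists (fun e => Tangent (wP e)) => [v|e].
  apply/val_inj/funext => d /=.
  by rewrite [RHS](rep_change v c d).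
have idc : 'd (c \o chart_inv c) (c p) = idfun :> (E -> E).
  have cod_near : nbhs (c p) (chart_cod c).
    apply: open_nbhs_nbhs; split; first exact: chart_cod_open.
    by exists p => //; exact: chart_of_dom.
  have nid : \forall x \near c p, idfun x = (c \o chart_inv c) x.
    by apply: filterS cod_near => _ [q cq <-] /=; rewrite chart_funK.
  have [_ ->] := near_eq_diff nid (@ex_diff _ _ _ _ _ _ _ (is_diff_id (c p))).
  exact: diff_val.
by rewrite /= /w idc.
Qed.

End ChangeOfChart.

Section Subdifferential.
Context {R : realType} {E : hilbertType R} {M : riemannianManifold E}.

(* For [phi] of class C^1 the choice of the chart is irrelevant and the functional
   is bounded, see [differentialE]; [insubd] returns 0 on unbounded ones. *)
Definition differential (phi : M -> R) (p : M) : cotangent_space p :=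
  insubd 0 (fun v : tangent_space p =>
    'd (phi \o chart_inv (some_chart p) : E -> R^o)
       (some_chart p p) (rep v (some_chart p))).

Lemma differentialE (phi : M -> R) (p : M) (c : chart_at p)
    (v : tangent_space p) : C1 phi ->
  differential phi p v = 'd (phi \o chart_inv c : E -> R^o) (c p) (rep v c).
Proof.
move=> phi1; pose c0 := some_chart p.
have dphi (d : chart_at p) :
    differentiable (phi \o chart_inv d : E -> R^o) (d p).
  have [+ _] := phi1 d (chart_of_atlas d); apply.
  by exists p => //; exact: chart_of_dom.
transitivity ('d (phi \o chart_inv c0 : E -> R^o) (c0 p) (rep v c0)).
  rewrite /differential val_insubd ifT//.
  pose h (u : tangent_space p) : R^o :=
    'd (phi \o chart_inv c0 : E -> R^o) (c0 p) (rep u c0).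
  have hl : linear h by move=> a u w; rewrite /h /= linearP.
  pose hL : {linear tangent_space p -> R^o} :=
    HB.pack h (GRing.isLinear.Build R _ _ *:%R h hl).
  apply/blin_predP; split; first exact: hl.
  apply: (@bounded_linear_continuous _ _ _ hL).
  apply/linear_boundedP.
  have /(_ 0) := diff_continuous (dphi c0).
  move=> /(continuous_linear_bounded 0)/linear_boundedP/pinfty_ex_gt0[K K0 hK].
  have [a [b [a0 b0 ab]]] := metric_equiv c0.
  near=> r => u; apply: le_trans (hK _) _.
  have /andP[au _] := ab u.
  rewrite -[X in _ * X](mulKf (lt0r_neq0 a0)) mulrA.
  apply: ler_pM.
  - by rewrite divr_ge0// ltW.
  - by rewrite mulr_ge0// ltW.
  - by near: r; apply: nbhs_pinfty_ge; rewrite num_real.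
  - exact: au.
rewrite (@diff_change_chart _ _ _ _ _ phi c c0)//=; congr ('d _ _ _).
by rewrite (rep_change v c c0).
Unshelve. all: by end_near. Qed.

Definition subdifferential (f : M -> R) (p : M) : set (cotangent_space p) :=
  [set differential phi p | phi in [set phi : M -> R |
    C1 phi /\ \forall q \near p, f p - phi p <= f q - phi q]].

Definition subdifferentiable (f : M -> R) (p : M) : Prop :=
  @subdifferential f p !=set0.

End Subdifferential.
Arguments differential {R E M} phi p.
Arguments subdifferential {R E M} f p _.
Arguments subdifferentiable {R E M} f p.

(* Main.v *)
Require Import Defs.
From mathcomp Require Import all_boot all_order all_algebra.
From mathcomp Require Import boolp classical_sets functions reals.
From mathcomp Require Import topology normedtype derive.

Import Order.TTheory GRing.Theory Num.Theory numFieldNormedType.Exports.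

Local Open Scope classical_set_scope.
Local Open Scope ring_scope.

(** A covector lies in the subdifferential of [f] at [p] exactly when it is the
    differential of a C^1 function that minorizes [f] near [p] and agrees with
    [f] at [p]: subtracting a constant from a test function turns the local
    minimum of the difference into the value 0 ([subdifferentialP]).

    Let [psi1] and [psi2] be such minorants of [f1] and [f2]. By the Leibniz
    rule [differentialM], the product [psi1 * psi2] has the differential
    required of an element of the Minkowski sum, so it suffices that it
    minorizes [f1 * f2] near [p]. It does as soon as one factor, say [f2], is
    positive at [p]: by continuity [psi2 > 0] near [p], and then
      [psi1 * psi2 <= f1 * psi2 <= f1 * f2],
    where the second inequality uses [0 <= f1] ([near_le_mul_minorants]).
    If both factors vanish at [p], then [psi1] and [psi2] may both be negative
    near [p] and their product may exceed [f1 * f2]; but then the Minkowski sum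
    is reduced to 0, which is the differential of the constant minorant 0.

    The supporting calculus says that C^1 functions form an algebra. The
    derivative of a sum or product is computed in charts, and its continuity is
    read off the formula, valid on an open set, that expresses it through the
    derivatives of the two functions. *)

Section ContinuouslyDifferentiable.
Context {R : realType} {V : normedModType R}.

(** The equality of functions [frechetE] is used pointwise, where both sides are
    values in [W] and no comparison of bundled linear maps is involved. *)
Lemma frechet_app {W : normedModType R} [f : V -> W] [x : V] (v : V) :
  differentiable f x -> frechet f x v = 'd f x v.
Proof. by move=> df; exact: (congr1 (@^~ v) (frechetE df)). Qed.

Lemma frechet_cst {W : normedModType R} (a : W) (x : V) :
  frechet (cst a : V -> W) x = 0.
Proof.
apply/val_inj/funext => v.
apply: etrans (frechet_app v (differentiable_cst a x)) _.
exact: (congr1 (@^~ v) (diff_cst a x)).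
Qed.

Lemma frechetD {W : normedModType R} (f g : V -> W) (x : V) :
  differentiable f x -> differentiable g x ->
  frechet (f + g) x = frechet f x + frechet g x.
Proof.
move=> df dg; apply/val_inj/funext => v.
apply: etrans (frechet_app v (differentiableD df dg)) _.
apply: etrans (congr1 (@^~ v) (diffD df dg)) _.
exact: (congr2 +%R (esym (frechet_app v df)) (esym (frechet_app v dg))).
Qed.

Lemma frechetM (f g : V -> R^o) (x : V) :
  differentiable f x -> differentiable g x ->
  frechet (f * g : V -> R^o) x = f x *: frechet g x + g x *: frechet f x.
Proof.
move=> df dg; apply/val_inj/funext => v.
have dfg := @differentiableM R V f g x df dg.
apply: etrans (@frechet_app R^o (f * g) x v dfg) _.
apply: etrans (congr1 (@^~ v) (@diffM R V f g x df dg)) _.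
exact: (congr2 (fun a b => f x *: a + g x *: b)
  (esym (frechet_app v dg)) (esym (frechet_app v df))).
Qed.

Lemma continuous_near_eq {T S : topologicalType} (f g : T -> S) (x : T) :
  (\forall y \near x, f y = g y) -> {for x, continuous f} ->
  {for x, continuous g}.
Proof.
move=> fg; rewrite /prop_for /continuous_at (nbhs_singleton fg).
by apply: cvg_trans; exact: near_eq_cvg.
Qed.

Lemma Ck_on1_cst {W : normedModType R} (U : set V) (a : W) :
  Ck_on 1 U (cst a : V -> W).
Proof.
split=> [x _|x _]; first exact: differentiable_cst.
rewrite (_ : frechet (cst a : V -> W) = cst 0); first exact: cst_continuous.
by apply/funext => y; rewrite frechet_cst.
Qed.

(** Openness of [U] makes the formula for the derivative hold on a neighbourhood
    of each point of [U], as its continuity there requires. *)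
Lemma Ck_on1D {W : normedModType R} [U : set V] [f g : V -> W] : open U ->
  Ck_on 1 U f -> Ck_on 1 U g -> Ck_on 1 U (f + g).
Proof.
move=> oU [df cf] [dg cg]; split=> x Ux.
  by apply: differentiableD; [exact: df|exact: dg].
apply: (@continuous_near_eq _ _ (fun y => frechet f y + frechet g y)).
  have : nbhs x U by exact: open_nbhs_nbhs.
  by apply: filterS => y Uy; rewrite frechetD//; [exact: df|exact: dg].
by apply: cvgD; [exact: cf|exact: cg].
Qed.

Lemma Ck_on1M [U : set V] [f g : V -> R^o] : open U ->
  Ck_on 1 U f -> Ck_on 1 U g -> Ck_on 1 U (f * g : V -> R^o).
Proof.
move=> oU [df cf] [dg cg]; split=> x Ux.
  by apply: differentiableM; [exact: df|exact: dg].
apply: (@continuous_near_eq _ _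
  (fun y => f y *: frechet g y + g y *: frechet f y)).
  have : nbhs x U by exact: open_nbhs_nbhs.
  by apply: filterS => y Uy; rewrite frechetM//; [exact: df|exact: dg].
have cnt h : differentiable h x -> h y @[y --> x] --> h x.
  exact: differentiable_continuous.
apply: cvgD; apply: cvgZ.
- exact/cnt/df.
- exact: cg.
- exact/cnt/dg.
- exact: cf.
Qed.

End ContinuouslyDifferentiable.

Section ContinuouslyDifferentiableOnManifold.
Context {R : realType} {E : hilbertType R} {M : riemannianManifold E}.
Implicit Types (phi psi : M -> R) (p : M).

Lemma C1_cst (a : R) : C1 (cst a : M -> R).
Proof. by move=> c _; exact: Ck_on1_cst. Qed.

Lemma C1D [phi psi] : C1 phi -> C1 psi -> C1 (phi + psi).
Proof.
move=> phi1 psi1 c ac.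
exact: (Ck_on1D (chart_cod_open c) (phi1 c ac) (psi1 c ac)).
Qed.

Lemma C1M [phi psi] : C1 phi -> C1 psi -> C1 (phi * psi).
Proof.
move=> phi1 psi1 c ac.
exact: (Ck_on1M (chart_cod_open c) (phi1 c ac) (psi1 c ac)).
Qed.

Lemma C1_differentiable [phi p] (c : chart_at p) : C1 phi ->
  differentiable (phi \o chart_inv c : E -> R^o) (c p).
Proof.
move=> phi1; have [+ _] := phi1 c (chart_of_atlas c); apply.
by exists p => //; exact: chart_of_dom.
Qed.

(** Continuity of [phi] on the manifold is that of its expression in a chart,
    since [phi] is near [p] the composite of that expression with the chart. *)
Lemma C1_continuous [phi] p : C1 phi -> {for p, continuous phi}.
Proof.
move=> phi1; pose c := some_chart p; have cp := chart_of_dom c.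
apply: (@continuous_near_eq _ _ ((phi \o chart_inv c) \o c)).
  have : nbhs p (chart_dom c).
    by apply: open_nbhs_nbhs; split=> //; exact: chart_dom_open.
  by apply: filterS => q cq /=; rewrite chart_funK.
apply: continuous_comp; first exact: chart_fun_continuous.
exact: differentiable_continuous (C1_differentiable _ phi1).
Qed.

Lemma differential_cst (a : R) p : differential (cst a) p = 0.
Proof.
apply/val_inj/funext => v; pose c := some_chart p.
apply: etrans (differentialE c v (C1_cst a)) _.
exact: (congr1 (@^~ (rep v c)) (diff_cst (a : R^o) (c p))).
Qed.

Lemma differentialD [phi psi] p : C1 phi -> C1 psi ->
  differential (phi + psi) p = differential phi p + differential psi p.
Proof.
move=> phi1 psi1; apply/val_inj/funext => v; pose c := some_chart p.
have dphi := C1_differentiable c phi1; have dpsi := C1_differentiable c psi1.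
apply: etrans (differentialE c v (C1D phi1 psi1)) _.
apply: etrans (congr1 (@^~ (rep v c)) (diffD dphi dpsi)) _.
exact: (congr2 +%R (esym (differentialE c v phi1))
                   (esym (differentialE c v psi1))).
Qed.

Lemma differentialM [phi psi] p : C1 phi -> C1 psi ->
  differential (phi * psi) p =
  phi p *: differential psi p + psi p *: differential phi p.
Proof.
move=> phi1 psi1; apply/val_inj/funext => v; pose c := some_chart p.
have dphi := C1_differentiable c phi1; have dpsi := C1_differentiable c psi1.
apply: etrans (differentialE c v (C1M phi1 psi1)) _.
apply: etrans (congr1 (@^~ (rep v c)) (diffM dphi dpsi)) _.
rewrite /= chart_funK; last exact: chart_of_dom.
exact: (congr2 (fun a b : R^o => phi p *: a + psi p *: b)
  (esym (differentialE c v psi1)) (esym (differentialE c v phi1))).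
Qed.

End ContinuouslyDifferentiableOnManifold.

Section ProductRule.
Context {R : realType} {E : hilbertType R} {M : riemannianManifold E}.

(** Adding [f p - phi p] to a test function [phi] changes neither its regularity
    nor its differential, and makes it touch the graph of [f] from below. *)
Lemma subdifferentialP (f : M -> R) (p : M) xi :
  subdifferential f p xi <-> exists psi : M -> R,
    [/\ C1 psi, psi p = f p, \forall q \near p, psi q <= f q
      & differential psi p = xi].
Proof.
split=> [[phi [phi1 phif] <-]|[psi [psi1 psip psif <-]]].
  exists (phi + cst (f p - phi p)); split.
  - exact: (C1D phi1 (C1_cst _)).
  - by rewrite !fctE subrKC.
  - by apply: filterS phif => q phifq; rewrite !fctE -lerBrDl.
  - by rewrite (differentialD p phi1 (C1_cst _)) differential_cst addr0.
exists psi => //; split=> //; apply: filterS psif => q.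
by rewrite psip subrr subr_ge0.
Qed.

(** Only one factor has to be positive at [p]: the chain
    [psi * chi <= f * chi <= f * g] multiplies once by [chi], which is positive
    near [p], and once by [f], which is nonnegative, so the sign of [psi] is
    free. *)
Lemma near_le_mul_minorants (f g psi chi : M -> R) (p : M) :
  (forall q, 0 <= f q) -> C1 chi -> chi p = g p -> 0 < g p ->
  (\forall q \near p, psi q <= f q) -> (\forall q \near p, chi q <= g q) ->
  \forall q \near p, psi q * chi q <= f q * g q.
Proof.
move=> f_ge0 chi1 chip gp psif chig.
have chi_gt0 : \forall q \near p, 0 < chi q.
  have := C1_continuous p chi1 => /cvgr_gt; apply; by rewrite chip.
near=> q.
have chiq : 0 < chi q by near: q.
apply: (@le_trans _ _ (f q * chi q)).
  by rewrite ler_wpM2r ?(ltW chiq)//; near: q.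
by rewrite ler_wpM2l//; near: q.
Unshelve. all: by end_near. Qed.

(** The Leibniz rule for single covectors; the test function is the product of
    the two minorants unless both [f] and [g] vanish at [p]. *)
Lemma subdifferentialM (f g : M -> R) (p : M) xi eta :
  (forall q, 0 <= f q) -> (forall q, 0 <= g q) ->
  subdifferential f p xi -> subdifferential g p eta ->
  subdifferential (f * g) p (f p *: eta + g p *: xi).
Proof.
move=> f_ge0 g_ge0 /subdifferentialP[psi [psi1 psip psif psixi]].
move=> /subdifferentialP[chi [chi1 chip chig chieta]].
apply/subdifferentialP.
have [fg0|fg_neq0] := boolP ((f p == 0) && (g p == 0)).
  have [/eqP fp0 /eqP gp0] := andP fg0.
  (* The covector is 0 and f * g is nonnegative, so 0 is a minorant. *)
  exists (cst 0); split; first exact: C1_cst.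
  - by rewrite !fctE fp0 mul0r.
  - by apply: nearW => q; rewrite mulr_ge0.
  - rewrite fp0 gp0 (scale0r eta) (scale0r xi) addr0.
    exact: differential_cst.
exists (psi * chi); split; first exact: (C1M psi1 chi1).
- by rewrite !fctE psip chip.
- have [gp0|gp_neq0] := eqVneq (g p) 0.
    have fp : 0 < f p.
      by rewrite lt_def f_ge0 andbT; move: fg_neq0; rewrite gp0 eqxx andbT.
    have := near_le_mul_minorants g f chi psi p g_ge0 psi1 psip fp chig psif.
    by apply: filterS => q; rewrite mulrC [leRHS]mulrC.
  have gp : 0 < g p by rewrite lt_def gp_neq0 g_ge0.
  exact: (near_le_mul_minorants f g psi chi p f_ge0 chi1 chip gp psif chig).
- by rewrite (differentialM p psi1 chi1) psip chip psixi chieta.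
Qed.

End ProductRule.

Theorem proposition4p14 (R : realType) (E : hilbertType R)
    (M : riemannianManifold E) (f1 f2 : M -> R) (p : M)
    (f1_ge0 : forall q : M, 0 <= f1 q) (f2_ge0 : forall q : M, 0 <= f2 q)
    (df1 : subdifferentiable f1 p) (df2 : subdifferentiable f2 p) :
  let f1f2 : M -> R := fun q => f1 q * f2 q in
  subdifferentiable f1f2 p /\
  [set xi + eta | xi in [set f1 p *: zeta | zeta in subdifferential f2 p]
                & eta in [set f2 p *: zeta | zeta in subdifferential f1 p]]
    `<=` subdifferential f1f2 p.
Proof.
move=> f1f2; split; last first.
  move=> _ [_ [zeta2 d2 <-]] [_ [zeta1 d1 <-] <-].
  exact: subdifferentialM.
have [[zeta1 d1] [zeta2 d2]] := (df1, df2).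
by exists (f1 p *: zeta2 + f2 p *: zeta1); exact: subdifferentialM.
Qed.
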